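(* Let $F_q(t)=\det(I-M(t)^q)$ for integers $q\ge 0$, and let $E$ be the forward shift operator on sequences indexed by $q$, $E(F_q)=F_{q+1}$. Then the sequence $F_q(t)$ is annihilated by the operator $L(E)=(E-1)(E+t)P_1(E)P_2(E)$, where $$P_1(E)=E^3+(2t+t^{-1}-2)E^2+(t^2-2t+2)E+t,$$ $$P_2(E)=E^3-(t^2-2t+2)E^2+(2t^2-2t+1)E-t^2.$$
   Context: $M(t)=\begin{pmatrix}1-t&1-t^{-1}&-1\\1&1-t^{-1}&-1\\0&t&-t\end{pmatrix}$, a matrix over $\mathbb{Z}[t,t^{-1}]$ (the image of $\sigma_1\sigma_2^{-1}\sigma_3\in B_4$ under the reduced Burau representation). Elements of $\mathbb{Z}[t,t^{-1}]$ act on sequences by scalar multiplication, so a polynomial $\sum_i p_iE^i$ sends the sequence $(F_q)$ to $(\sum_i p_iF_{q+i})$. *)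

(* Defs.v *)
From HB Require Import structures.
From mathcomp Require Import all_boot all_order all_algebra.
From mathcomp Require Import boolp.

Set Implicit Arguments.
Unset Strict Implicit.
Unset Printing Implicit Defensive.

Import GRing.Theory.
Local Open Scope ring_scope.

(* Z[t, t^-1] is the subring of the fractions p / t^n in the fraction field
   of Z[t]. *)
Definition is_laurent : {pred {fraction {poly int}}} :=
  fun x => `[< exists (p : {poly int}) (n : nat),
                 x = FracField.tofrac p / FracField.tofrac 'X ^+ n >].

Lemma is_laurentP (x : {fraction {poly int}}) :
  reflect (exists (p : {poly int}) (n : nat),
             x = FracField.tofrac p / FracField.tofrac 'X ^+ n)
          (x \in is_laurent).
Proof. exact: asboolP. Qed.

Lemma tofracX_neq0 : FracField.tofrac ('X : {poly int}) != 0.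
Proof. by rewrite tofrac_eq0 polyX_eq0. Qed.

Lemma is_laurent_subring : subring_closed is_laurent.
Proof.
have X0 n : FracField.tofrac ('X : {poly int}) ^+ n != 0.
  by rewrite expf_neq0 // tofracX_neq0.
split=> [|x y|x y].
- by apply/is_laurentP; exists 1, 0%N; rewrite tofrac1 expr0 divr1.
- move=> /is_laurentP[p [m ->]] /is_laurentP[q [n ->]].
  apply/is_laurentP; exists (p * 'X^n - q * 'X^m), (m + n)%N.
  by rewrite -mulNr addf_div // exprD tofracB !tofracM !tofracXn mulNr.
- move=> /is_laurentP[p [m ->]] /is_laurentP[q [n ->]].
  apply/is_laurentP; exists (p * q), (m + n)%N.
  by rewrite mulf_div exprD tofracM.
Qed.

HB.instance Definition _ :=
  GRing.isSubringClosed.Build {fraction {poly int}} is_laurent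
    is_laurent_subring.

Record laurent := Laurent {
  laurent_val : {fraction {poly int}};
  laurent_valP : laurent_val \in is_laurent }.

HB.instance Definition _ := [isSub for laurent_val].
HB.instance Definition _ := [Choice of laurent by <:].
HB.instance Definition _ := [SubChoice_isSubComNzRing of laurent by <:].

Definition laurent_unit : {pred laurent} :=
  fun x => (val x != 0) && ((val x)^-1 \in is_laurent).

(* On non-units the inverse is the identity, as unitRingType requires. *)
Definition laurent_inv (x : laurent) : laurent := insubd x (val x)^-1.

Lemma laurent_mulVr : {in laurent_unit, left_inverse 1 laurent_inv *%R}.
Proof.
move=> x /andP[x0 xV]; apply: val_inj.
by rewrite rmorphM rmorph1 /= val_insubd xV mulVf.
Qed.

Lemma laurent_unitP (x y : laurent) : y * x = 1 -> laurent_unit x.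
Proof.
move=> /(congr1 val); rewrite rmorphM rmorph1 /= => yx.
have x0 : val x != 0 by apply: contra_eq_neq yx => ->; rewrite mulr0 eq_sym oner_eq0.
apply/andP; split=> //.
suff -> : (val x)^-1 = val y by exact: valP.
by apply: (mulIf x0); rewrite mulVf.
Qed.

Lemma laurent_inv_out : {in [predC laurent_unit], laurent_inv =1 id}.
Proof.
move=> x xU; apply: val_inj; rewrite val_insubd; case: ifP => // xV.
by have := xU; rewrite inE /= unfold_in xV andbT negbK => /eqP ->; rewrite invr0.
Qed.

HB.instance Definition _ := GRing.ComNzRing_hasMulInverse.Build laurent
  laurent_mulVr laurent_unitP laurent_inv_out.

Lemma tofracX_laurent : FracField.tofrac 'X \in is_laurent.
Proof. by apply/is_laurentP; exists 'X, 0%N; rewrite expr0 divr1. Qed.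

Definition t : laurent := Laurent tofracX_laurent.

Lemma t_unit : t \is a GRing.unit.
Proof.
apply/andP; split; first exact: tofracX_neq0.
by apply/is_laurentP; exists 1, 1%N; rewrite tofrac1 expr1 div1r.
Qed.

Definition M : 'M[laurent]_3 :=
  \matrix_(i, j) nth 0 (nth [::]
    [:: [:: 1 - t; 1 - t^-1; -1 ];
        [:: 1;     1 - t^-1; -1 ];
        [:: 0;     t;        - t ] ] i) j.

Definition F (q : nat) : laurent := \det (1 - M ^+ q).

Section ShiftOperators.
Variable R : nzRingType.

Definition shift (u : nat -> R) : nat -> R := fun q => u q.+1.

(* The operator p(E), with E = shift and the polynomial variable 'X for E. *)
Definition shift_op (p : {poly R}) (u : nat -> R) : nat -> R :=
  fun q => \sum_(i < size p) p`_i * iter i shift u q.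

Lemma iter_shift i u q : iter i shift u q = u (q + i)%N.
Proof. by elim: i q => [|i IHi] q; rewrite ?addn0 //= /shift IHi addSnnS. Qed.

Lemma shift_opX u q : shift_op 'X u q = shift u q.
Proof.
by rewrite /shift_op size_polyX !big_ord_recr big_ord0 /= !coefX mul0r !add0r mul1r.
Qed.

Definition annihilates (p : {poly R}) (u : nat -> R) : Prop :=
  forall q, shift_op p u q = 0.

End ShiftOperators.

Definition P1 : {poly laurent} :=
  'X^3 + (2 * t + t^-1 - 2)%:P * 'X^2 + (t ^+ 2 - 2 * t + 2)%:P * 'X + t%:P.

Definition P2 : {poly laurent} :=
  'X^3 - (t ^+ 2 - 2 * t + 2)%:P * 'X^2 + (2 * t ^+ 2 - 2 * t + 1)%:P * 'X
  - (t ^+ 2)%:P.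

Definition L : {poly laurent} := ('X - 1) * ('X + t%:P) * P1 * P2.

(* Main.v *)
Require Import Defs.
From mathcomp Require Import all_boot all_order all_algebra ring.

Set Implicit Arguments.
Unset Strict Implicit.
Unset Printing Implicit Defensive.

Import GRing.Theory.
Local Open Scope ring_scope.

(** Expanding [det (1 - B)] for a 3 x 3 matrix [B] by the elementary symmetric
    functions of its eigenvalues gives [1 - tr B + tr (adj B) - det B]
    ([det_1_sub3]).  Take [B = A ^+ q]: determinant and adjugate commute with
    powers, so
      [det (1 - A^q) = 1^q - tr (A^q) + tr ((adj A)^q) - (det A)^q]
    is a combination of four sequences, each of the form [q |-> f (x^q)] with
    [f] linear.  On such a sequence [p(E)] acts by
      [(p(E) u)_q = f (x^q * p(x))],
    hence it is killed by every polynomial vanishing at [x] ([shift_op_exp],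
    [shift_op_trace]).  The scalars [1] and [det A] are roots of [X - 1] and
    [X - det A], and by Cayley-Hamilton [A] and [adj A] are roots of their
    characteristic polynomials; the product of these four polynomials kills
    everything ([annihilates_det_1_sub_exp3]).

    For the Burau matrix [M], [det M = -t], and the characteristic polynomials
    of [M] and [adj M] are [P1] and [P2], so this product is [L].  *)

(** * The shift operator on sequences of powers *)

Section Sequences.
Variable R : comNzRingType.
Implicit Types (p : {poly R}) (u v : nat -> R).

Lemma shift_opE p u q : shift_op p u q = \sum_(i < size p) p`_i * u (q + i)%N.
Proof. by apply: eq_bigr => i _; rewrite iter_shift. Qed.

Lemma eq_shift_op p u v : u =1 v -> shift_op p u =1 shift_op p v.
Proof. by move=> uv q; rewrite !shift_opE; apply: eq_bigr => i _; rewrite uv. Qed.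

Lemma shift_opD p u v q :
  shift_op p (fun k => u k + v k) q = shift_op p u q + shift_op p v q.
Proof.
by rewrite !shift_opE -big_split; apply: eq_bigr => i _; rewrite mulrDr.
Qed.

Lemma shift_opN p u q : shift_op p (fun k => - u k) q = - shift_op p u q.
Proof. by rewrite !shift_opE -sumrN; apply: eq_bigr => i _; rewrite mulrN. Qed.

Lemma shift_op_exp p d q : shift_op p (GRing.exp d) q = d ^+ q * p.[d].
Proof.
rewrite shift_opE horner_coef mulr_sumr.
by apply: eq_bigr => i _; rewrite exprD mulrCA.
Qed.

(** A shift by [i] multiplies [A ^+ q] by [A ^+ i], so by linearity of the
    trace the whole operator inserts the factor [p(A)]. *)
Lemma shift_op_trace n (A : 'M[R]_n.+1) p q :
  shift_op p (fun k => \tr (A ^+ k)) q = \tr (A ^+ q * horner_mx A p).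
Proof.
rewrite shift_opE -[in RHS](coefK p) poly_def !linear_sum mulr_sumr linear_sum.
apply: eq_bigr => i _.
by rewrite linearZ /= rmorphXn /= horner_mx_X -scalerAr linearZ /= exprD.
Qed.

End Sequences.

(** * Determinant, adjugate and characteristic polynomial in size 3 *)

Section Matrix3.
Variable R : comNzRingType.
Implicit Types (A B : 'M[R]_3) (f g : nat -> nat -> R).

(** With entries indexed by natural numbers, ordinals coming from [lift] and
    [ord0] compute to numerals, so that identities between 3 x 3 matrices
    become polynomial identities in nine named entries. *)
Lemma mx3_fun A : {f : nat -> nat -> R | A = \matrix_(i, j) f i j}.
Proof.
exists (fun i j => A (inord i) (inord j)).
by apply/matrixP=> i j; rewrite mxE !inord_val.
Qed.

Lemma det_mx3 (S : comNzRingType) (f : nat -> nat -> S) :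
  \det (\matrix_(i < 3, j < 3) f i j) =
    f 0%N 0%N * (f 1%N 1%N * f 2%N 2%N - f 1%N 2%N * f 2%N 1%N)
  - f 0%N 1%N * (f 1%N 0%N * f 2%N 2%N - f 1%N 2%N * f 2%N 0%N)
  + f 0%N 2%N * (f 1%N 0%N * f 2%N 1%N - f 1%N 1%N * f 2%N 0%N).
Proof.
rewrite (expand_det_row _ ord0) !big_ord_recl big_ord0 /cofactor.
rewrite !(expand_det_row _ ord0) !big_ord_recl !big_ord0 /cofactor.
by rewrite !det_mx11 !mxE /= /bump /=; ring.
Qed.

Lemma trace_mx3 f :
  \tr (\matrix_(i < 3, j < 3) f i j) = f 0%N 0%N + f 1%N 1%N + f 2%N 2%N.
Proof. by rewrite /mxtrace !big_ord_recl big_ord0 !mxE addr0 addrA. Qed.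

(** The transposed table of the nine cofactors. *)
Definition adj3_entry f i j : R :=
  nth 0 (nth [::]
    [:: [:: f 1%N 1%N * f 2%N 2%N - f 1%N 2%N * f 2%N 1%N;
            f 0%N 2%N * f 2%N 1%N - f 0%N 1%N * f 2%N 2%N;
            f 0%N 1%N * f 1%N 2%N - f 0%N 2%N * f 1%N 1%N];
        [:: f 1%N 2%N * f 2%N 0%N - f 1%N 0%N * f 2%N 2%N;
            f 0%N 0%N * f 2%N 2%N - f 0%N 2%N * f 2%N 0%N;
            f 0%N 2%N * f 1%N 0%N - f 0%N 0%N * f 1%N 2%N];
        [:: f 1%N 0%N * f 2%N 1%N - f 1%N 1%N * f 2%N 0%N;
            f 0%N 1%N * f 2%N 0%N - f 0%N 0%N * f 2%N 1%N;
            f 0%N 0%N * f 1%N 1%N - f 0%N 1%N * f 1%N 0%N]] i) j.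

Lemma adj_mx3 f :
  \adj (\matrix_(i < 3, j < 3) f i j) = \matrix_(i < 3, j < 3) adj3_entry f i j.
Proof.
apply/matrixP=> i j; rewrite !mxE /cofactor.
rewrite !(expand_det_row _ ord0) !big_ord_recl !big_ord0 /cofactor.
rewrite !det_mx11 !mxE /=.
by case: i j => [[|[|[|//]]] ?] [[|[|[|//]]] ?]; rewrite /bump /adj3_entry /=; ring.
Qed.

(** The adjugate behaves like [det A *: A^-1]; over a commutative ring the
    identity holds because both sides are the same polynomials in the eighteen
    entries of [A] and [B]. *)
Lemma adj_mul3 A B : \adj (A * B) = \adj B * \adj A.
Proof.
have [f ->] := mx3_fun A; have [g ->] := mx3_fun B.
pose h i j := f i 0%N * g 0%N j + f i 1%N * g 1%N j + f i 2%N * g 2%N j.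
have -> : (\matrix_(i, j) f i j) * (\matrix_(i, j) g i j) =
          \matrix_(i < 3, j < 3) h i j.
  by apply/matrixP=> i j; rewrite !mxE !big_ord_recl big_ord0 !mxE /= /h /bump /=; ring.
rewrite !adj_mx3; apply/matrixP=> i j.
rewrite !mxE !big_ord_recl big_ord0 !mxE /=.
by case: i j => [[|[|[|//]]] ?] [[|[|[|//]]] ?]; rewrite /bump /adj3_entry /h /=; ring.
Qed.

Lemma adj_exp3 A q : \adj (A ^+ q) = \adj A ^+ q.
Proof.
elim: q => [|q IHq]; first by rewrite !expr0 adj1.
by rewrite exprS exprSr adj_mul3 IHq.
Qed.

Lemma det_exp n (A : 'M[R]_n.+1) q : \det (A ^+ q) = \det A ^+ q.
Proof.
elim: q => [|q IHq]; first by rewrite !expr0 det1.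
by rewrite !exprS det_mulmx IHq.
Qed.

(** The characteristic polynomial at 1: with eigenvalues [x], [y], [z] this is
    [(1 - x) (1 - y) (1 - z)], where [tr (adj A) = x y + x z + y z]. *)
Lemma det_1_sub3 A : \det (1 - A) = 1 - \tr A + \tr (\adj A) - \det A.
Proof.
have [f ->] := mx3_fun A.
pose h (i j : nat) := (i == j)%:R - f i j.
have -> : 1 - (\matrix_(i, j) f i j) = \matrix_(i < 3, j < 3) h i j.
  by apply/matrixP=> i j; rewrite !mxE.
rewrite !det_mx3 /h adj_mx3 !trace_mx3 /adj3_entry /=.
ring.
Qed.

Lemma char_poly3 A :
  char_poly A = 'X^3 - (\tr A)%:P * 'X^2 + (\tr (\adj A))%:P * 'X - (\det A)%:P.
Proof.
have [f ->] := mx3_fun A; rewrite /char_poly.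
pose h (i j : nat) := 'X *+ (i == j) - (f i j)%:P.
have -> : char_poly_mx (\matrix_(i, j) f i j) = \matrix_(i < 3, j < 3) h i j.
  by apply/matrixP=> i j; rewrite !mxE.
rewrite !det_mx3 /h adj_mx3 !trace_mx3 /adj3_entry /=.
ring.
Qed.

(** The trace of [adj (adj A) = (det A) A]; this and the next lemma supply the
    coefficients of [char_poly (\adj A)] through [char_poly3]. *)
Lemma trace_adj_adj3 A : \tr (\adj (\adj A)) = \det A * \tr A.
Proof.
have [f ->] := mx3_fun A.
rewrite adj_mx3 adj_mx3 det_mx3 !trace_mx3 /adj3_entry /=.
ring.
Qed.

Lemma det_adj3 A : \det (\adj A) = \det A ^+ 2.
Proof.
have [f ->] := mx3_fun A.
rewrite adj_mx3 !det_mx3 /adj3_entry /=.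
ring.
Qed.

(** Each of the four terms of [1^q - tr (A^q) + tr ((adj A)^q) - (det A)^q] is
    killed by one of the four factors. *)
Theorem annihilates_det_1_sub_exp3 A :
  annihilates (('X - 1) * ('X - (\det A)%:P) * char_poly A * char_poly (\adj A))
    (fun q => \det (1 - A ^+ q)).
Proof.
set p := _ * _ => q.
pose u k := 1 ^+ k - \tr (A ^+ k) + \tr (\adj A ^+ k) - \det A ^+ k.
have uE k : \det (1 - A ^+ k) = u k.
  by rewrite det_1_sub3 adj_exp3 det_exp /u expr1n.
have p1 : p.[1] = 0 by rewrite /p -polyC1 !hornerM hornerXsubC subrr !mul0r.
(* [1] unifies with [_%:P], so the root has to be given to [hornerXsubC]. *)
have pd : p.[\det A] = 0 by rewrite /p !hornerM (hornerXsubC (\det A)) subrr mulr0 !mul0r.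
have pA : horner_mx A p = 0 by rewrite /p !rmorphM /= Cayley_Hamilton mulr0 mul0r.
have padj : horner_mx (\adj A) p = 0 by rewrite /p rmorphM /= Cayley_Hamilton mulr0.
rewrite (eq_shift_op _ uE) !(shift_opD, shift_opN) !shift_op_exp !shift_op_trace.
by rewrite p1 pd pA padj !mulr0 !mxtrace0 !subr0 addr0.
Qed.

End Matrix3.

(** * The Burau matrix *)

Section BurauImage.
Variables (R : comNzRingType) (a b : R).
Hypothesis ab : a * b = 1.

(** The image of [sigma_1 sigma_2^-1 sigma_3] under the reduced Burau
    representation, with [a], [b] for [t], [t^-1].  In an abstract ring the
    computations stay symbolic, whereas [ring] would unfold the fractions that
    represent Laurent polynomials. *)
Definition burau_entry (i j : nat) : R :=
  nth 0 (nth [::]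
    [:: [:: 1 - a; 1 - b; -1 ];
        [:: 1;     1 - b; -1 ];
        [:: 0;     a;     - a ] ] i) j.

Definition burau : 'M[R]_3 := \matrix_(i, j) burau_entry i j.

Lemma det_burau : \det burau = - a.
Proof. by rewrite det_mx3 /burau_entry /=; ring: ab. Qed.

Lemma trace_burau : \tr burau = 2 - 2 * a - b.
Proof. by rewrite trace_mx3 /burau_entry /=; ring. Qed.

Lemma trace_adj_burau : \tr (\adj burau) = a ^+ 2 - 2 * a + 2.
Proof. by rewrite adj_mx3 trace_mx3 /adj3_entry /burau_entry /=; ring: ab. Qed.

Lemma char_poly_burau :
  char_poly burau =
    'X^3 + (2 * a + b - 2)%:P * 'X^2 + (a ^+ 2 - 2 * a + 2)%:P * 'X + a%:P.
Proof. by rewrite char_poly3 det_burau trace_burau trace_adj_burau; ring. Qed.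

Lemma char_poly_adj_burau :
  char_poly (\adj burau) =
    'X^3 - (a ^+ 2 - 2 * a + 2)%:P * 'X^2 + (2 * a ^+ 2 - 2 * a + 1)%:P * 'X
    - (a ^+ 2)%:P.
Proof.
have e2 : - a * (2 - 2 * a - b) = 2 * a ^+ 2 - 2 * a + 1 by ring: ab.
rewrite char_poly3 trace_adj_adj3 det_adj3 det_burau trace_burau.
by rewrite trace_adj_burau e2 sqrrN.
Qed.

End BurauImage.

Theorem lemma2p3 : annihilates L F.
Proof.
have tV : t * t^-1 = 1 := mulrV t_unit.
have ME : M = burau t t^-1 by [].
have -> : L = ('X - 1) * ('X - (\det M)%:P) * char_poly M * char_poly (\adj M).
  rewrite ME (char_poly_burau tV) (char_poly_adj_burau tV) (det_burau tV).
  by rewrite polyCN opprK.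
exact: annihilates_det_1_sub_exp3.
Qed.
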